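(* Let $\varphi,\psi:\mathbb{R}^n\to\mathbb{R}$ be any two functions such that $f=e^{-\varphi}$ and $g=e^{-\psi}$ are integrable. If $J(f)>0$ and $J(g)>0$, then $$\widehat{\delta J}(f,g)\ge\widehat{\delta J}(f,f)+J(f)\log\frac{J(f)}{J(g)},$$ with equality if and only if $f=ag$ for some $a>0$.
   Context: For an integrable function $h$ on $\mathbb{R}^n$, $J(h)=\int_{\mathbb{R}^n}h(x)\,dx$. For $f=e^{-\varphi}$, $g=e^{-\psi}$ integrable, the functional dual mixed volume is $$\widehat{\delta J}(f,g)=-\lim_{t\to0^+}\frac{J(e^{-(\varphi+t\psi)})-J(f)}{t}.$$
   Formalization: Limits and dual mixed volumes may be infinite; ''equality only if f=ag'' is asserted when the dual mixed volume of (f,f) is finite (it fails otherwise), f=ag is understood almost everywhere, and n≥1. *)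

(* Defs.v *)
From HB Require Import structures.
From mathcomp Require Import all_boot all_order all_algebra.
From mathcomp Require Import all_classical all_reals all_analysis.

Set Implicit Arguments.
Unset Strict Implicit.
Unset Printing Implicit Defensive.

Import Order.TTheory GRing.Theory Num.Theory.
Import numFieldNormedType.Exports.

Local Open Scope classical_set_scope.
Local Open Scope ring_scope.

(* Lebesgue measure on R^n, in the classical way: the outer measure is the
   infimum of the total volume over countable covers by boxes, and the measure
   is its restriction to the Caratheodory-measurable sets.  The dimension is
   written n.+1: in dimension 0 every box would be the whole one-point space,
   and the empty set would have no cover of small volume. *)
Section lebesgue_outer_measure.
Context (R : realType) (n : nat).
Local Notation Rn := 'rV[R]_n.+1.

Definition box (c : Rn * Rn) : set Rn :=
  [set x | forall i, c.1 ord0 i < x ord0 i <= c.2 ord0 i].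

Definition box_volume (c : Rn * Rn) : \bar R :=
  (\prod_i Num.max 0 (c.2 ord0 i - c.1 ord0 i))%:E.

Definition box_cover (X : set Rn) : set (nat -> Rn * Rn) :=
  [set c | X `<=` \bigcup_k box (c k)].

Definition lebesgue_outer (X : set Rn) : \bar R :=
  ereal_inf [set (\sum_(k <oo) box_volume (c k))%E | c in box_cover X].

Local Open Scope ereal_scope.

Let box_volume_ge0 c : 0 <= box_volume c.
Proof. by rewrite lee_fin; apply: prodr_ge0 => i _; rewrite le_max lexx. Qed.

Let lebesgue_outer_ge0 X : 0 <= lebesgue_outer X.
Proof. by apply: le_ereal_inf_tmp => _ [c _ <-]; exact: nneseries_ge0. Qed.

Let lebesgue_outer0 : lebesgue_outer set0 = 0.
Proof.
apply/eqP; rewrite eq_le lebesgue_outer_ge0 andbT.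
apply: ereal_inf_lbound; exists (fun=> (0%R, 0%R)) => //.
by rewrite eseries0// => k _ _; rewrite /box_volume big_ord_recl subrr maxxx mul0r.
Qed.

Let le_lebesgue_outer : {homo lebesgue_outer : A B / A `<=` B >-> A <= B}.
Proof.
move=> A B AB; apply/ereal_inf_le_tmp => _ [c Bc <-].
by exists c => //; exact: subset_trans Bc.
Qed.

Let lebesgue_outer_sigma_subadditive : sigma_subadditive lebesgue_outer.
Proof.
move=> A; have [[i ioo]|] := pselect (exists i, lebesgue_outer (A i) = +oo).
  rewrite (eseries_pinfty _ _ ioo) ?leey// => k _.
  by rewrite -ltNye (lt_le_trans _ (lebesgue_outer_ge0 _)).
rewrite -forallNE => Aoo; apply/lee_addgt0Pr => _/posnumP[e].
rewrite (le_trans _ (epsilon_trick _ _ _))//.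
pose P k c := box_cover (A k) c /\
  \sum_(j <oo) box_volume (c j) <= lebesgue_outer (A k) + (e%:num / (2 ^ k.+1)%:R)%:E.
have [G PG] : {G : nat -> nat -> Rn * Rn & forall k, P k (G k)}.
  apply: (@choice _ _ P) => k; rewrite /P.
  have fA : lebesgue_outer (A k) \is a fin_num.
    by rewrite ge0_fin_numE// ltey; apply/eqP; exact: Aoo.
  have e0 : (0 < e%:num / (2 ^ k.+1)%:R)%R by [].
  have [_ [c Ac <-] cA] := lb_ereal_inf_adherent e0 fA.
  by exists c; split => //; exact/ltW.
have /card_esym/ppcard_eqP[f] := card_nat2.
apply: (@le_trans _ _ (\esum_(i in setT) (box_volume \o uncurry G) i)).
  apply: ereal_inf_lbound => /=; exists (uncurry G \o f).
    move=> x [k _ /(PG k).1[j _ Gx]].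
    by exists (f^-1%FUN (k, j)) => //=; rewrite invK ?inE.
  rewrite -(esum_pred_image (box_volume \o uncurry G) _ xpredT) ?[fun=> _]set_true//.
    by rewrite image_eq.
  by move=> ? _; exact: box_volume_ge0.
rewrite (_ : esum _ _ = \sum_(i <oo) \sum_(j <oo) box_volume (G i j)); last first.
  rewrite (_ : setT = \bigcup_k [set (k, j) | j in [set: nat]]); last first.
    by rewrite predeqE => -[a b]; split => // _; exists a => //; exists b.
  rewrite esum_bigcupT /=; last 2 first.
  - apply/trivIsetP => i j _ _ ij.
    rewrite predeqE => -[k m] /=; split => //= -[] [_] _ [<-{k} _].
    by move=> [m' _] [] /esym/eqP; rewrite (negbTE ij).
  - by move=> ?; exact: box_volume_ge0.
  rewrite -(image_id [set: nat]) -fun_true esum_pred_image//; last first.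
    by move=> k _; apply: esum_ge0 => ? _; exact: box_volume_ge0.
  apply: eq_eseriesr => /= j _.
  rewrite -(esum_pred_image (box_volume \o uncurry G) (pair j) predT)//=; last first.
    by move=> ? ? _ _; exact: (@can_inj _ _ _ snd).
  by congr esum; rewrite predeqE => -[a b]; split; move=> [i _ <-]; exists i => //; exists i.
apply: lee_nneseries => [k _ _|k _]; last exact: (PG k).2.
by apply: nneseries_ge0 => *; exact: box_volume_ge0.
Qed.

HB.instance Definition _ := isOuterMeasure.Build R Rn lebesgue_outer
  lebesgue_outer0 lebesgue_outer_ge0 le_lebesgue_outer
  lebesgue_outer_sigma_subadditive.

End lebesgue_outer_measure.

Section functionals.
Context (R : realType) (n : nat).
Local Notation Rn := (caratheodory_type (@lebesgue_outer R n)).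

Definition lebesgue_Rn : set Rn -> \bar R := @lebesgue_outer R n.

HB.instance Definition _ := isMeasure.Build _ Rn R lebesgue_Rn
  (caratheodory_measure0 (@lebesgue_outer R n))
  (@caratheodory_measure_ge0 _ _ (@lebesgue_outer R n))
  (@caratheodory_measure_sigma_additive _ _ (@lebesgue_outer R n)).

Definition integrable_Rn (h : 'rV[R]_n.+1 -> R) : Prop :=
  lebesgue_Rn.-integrable [set: Rn] (EFin \o h).

(* J has values in \bar R since exp(-(phi + t psi)) is a nonnegative measurable
   function that need not be integrable. *)
Definition J (h : 'rV[R]_n.+1 -> R) : \bar R :=
  (\int[lebesgue_Rn]_x (h x)%:E)%E.

Definition expN (phi : 'rV[R]_n.+1 -> R) : 'rV[R]_n.+1 -> R :=
  fun x => expR (- phi x).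

(* The dual mixed volume of f = expN phi and g = expN psi.  Since
   t |-> exp(-(phi + t psi)) is convex, the quotient is nondecreasing in t > 0,
   so for integrable f the limit exists in \bar R, possibly infinite. *)
Definition dual_mixed_volume (phi psi : 'rV[R]_n.+1 -> R) : \bar R :=
  (- lim ((fun t : R =>
     (J (expN (fun x => phi x + t * psi x)%R) - J (expN phi)) * t^-1%:E)
       @ 0^'+))%E.

End functionals.

(* Main.v *)
(** Write I(phi) for the integral of exp(-phi) and Q(phi, psi, t) for the
    difference quotient (I(phi + t psi) - I(phi)) / t, nondecreasing in t by
    convexity, so that the dual mixed volume is -inf Q.  Adding a constant c to
    psi adds c I(phi) to the dual mixed volume, so one may assume
    I(psi) = I(phi).  For t = s / (1 + s), the potential phi + t psi equals
    (1 - t)(phi + s phi) + t psi, and convexity of exp then gives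
    Q(phi, psi, t) <= Q(phi, phi, s), which is the inequality.  The loss in this
    step is at least the integral of a nonnegative function which tends, as
    s -> 0, to exp(-psi) - exp(-phi) (1 + phi - psi); in the equality case
    Fatou's lemma makes this limit vanish almost everywhere, whence
    phi = psi. *)
Require Import Defs.
From mathcomp Require Import all_boot all_order all_algebra.
From mathcomp Require Import all_classical all_reals all_analysis.
From mathcomp Require Import measurable_realfun.
From mathcomp Require Import ring lra.
Import Order.TTheory GRing.Theory Num.Theory.
Import numFieldNormedType.Exports.
Local Open Scope classical_set_scope.
Local Open Scope ring_scope.

(** * Integrals of exponentials over an abstract measure space *)

Section exponential_integral.
Context (d : measure_display) (T : measurableType d) (R : realType).
Context (mu : {measure set T -> \bar R}).
Implicit Types phi psi : T -> R.

Definition int_expN phi : \bar R := (\int[mu]_x (expR (- phi x))%:E)%E.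

Definition int_expN_quot phi psi (t : R) : \bar R :=
  ((int_expN (fun x => phi x + t * psi x)%R - int_expN phi) * t^-1%:E)%E.

Lemma measurable_expN phi : measurable_fun setT phi ->
  measurable_fun setT (EFin \o (fun x => expR (- phi x))).
Proof.
move=> mphi; apply/measurable_EFinP.
by apply: measurableT_comp => //; exact: measurable_funN.
Qed.

(** The theorem assumes only that exp(-phi) is integrable; measurability of [phi] itself is
    recovered by taking the logarithm. *)
Lemma measurable_potential phi :
  measurable_fun setT (EFin \o (fun x => expR (- phi x))) ->
  measurable_fun setT phi.
Proof.
move=> /measurable_EFinP mf.
rewrite (_ : phi = \- (@ln R \o (fun x => expR (- phi x)))); last first.
  by apply/funext => x /=; rewrite expRK opprK.
by apply: measurable_funN; apply: measurableT_comp.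
Qed.

Lemma int_expN_ge0 phi : (0 <= int_expN phi)%E.
Proof. by apply: integral_ge0 => x _; rewrite lee_fin expR_ge0. Qed.

Lemma int_expN_shift phi (c : R) : measurable_fun setT phi ->
  int_expN (fun x => phi x + c) = ((expR (- c))%:E * int_expN phi)%E.
Proof.
move=> mphi; rewrite /int_expN -ge0_integralZl_EFin ?expR_ge0//.
- by apply: eq_integral => x _; rewrite -EFinM -expRD opprD (addrC (- c)).
- exact: measurable_expN.
Qed.

Lemma int_expN_ae_eq phi psi :
  measurable_fun setT phi -> measurable_fun setT psi ->
  {ae mu, forall x, phi x = psi x} -> int_expN phi = int_expN psi.
Proof.
move=> mphi mpsi e; apply: ae_eq_integral; [by []|exact: measurable_expN..|].
by move: e; apply: filterS => x + _ => /= ->.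
Qed.

(** * Convexity of the exponential with an explicit remainder *)

(* [exp] minus its tangent line at [- m], evaluated at [- b]. *)
Definition tangent_gap (m b : R) : R := expR (- b) - expR (- m) * (1 + m - b).

Lemma tangent_gapE (m b : R) :
  tangent_gap m b = expR (- m) * (expR (m - b) - (1 + (m - b))).
Proof. by rewrite /tangent_gap [RHS]mulrBr -expRD addKr addrA. Qed.

Lemma tangent_gap_ge0 (m b : R) : 0 <= tangent_gap m b.
Proof. by rewrite tangent_gapE mulr_ge0 ?expR_ge0// subr_ge0 expR_ge1Dx. Qed.

Lemma tangent_gap_eq0 (m b : R) : tangent_gap m b = 0 -> m = b.
Proof.
rewrite tangent_gapE => /eqP; rewrite mulf_eq0 gt_eqF ?expR_gt0//= subr_eq0.
have [/eqP mb _|/expR_gt1Dx /[swap] /eqP ->] := eqVneq (m - b) 0.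
  by apply/eqP; rewrite -subr_eq0.
by rewrite ltxx.
Qed.

Lemma measurable_tangent_gap phi psi :
  measurable_fun setT phi -> measurable_fun setT psi ->
  measurable_fun setT (EFin \o (fun x => tangent_gap (phi x) (psi x))).
Proof.
move=> mphi mpsi; apply/measurable_EFinP.
have /measurable_EFinP ephi := measurable_expN _ mphi.
have /measurable_EFinP epsi := measurable_expN _ mpsi.
apply: measurable_funB => //; apply: measurable_funM => //.
by apply: measurable_funB => //; exact: measurable_funD.
Qed.

(** Since [m] is the weighted mean of [a] and [b], the tangent line averages exactly to exp(-m). The
    two sides therefore differ by (1 - t) times the gap at [a], which is nonnegative. *)
Lemma expR_convex_gap (t a b : R) (m := (1 - t) * a + t * b) : 0 <= t <= 1 ->
  expR (- m) + t * tangent_gap m b <= (1 - t) * expR (- a) + t * expR (- b).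
Proof.
move=> /andP[t0 t1].
rewrite -subr_ge0.
have -> : (1 - t) * expR (- a) + t * expR (- b) -
    (expR (- m) + t * tangent_gap m b) = (1 - t) * tangent_gap m a.
  by rewrite /tangent_gap /m; ring.
by rewrite mulr_ge0 ?tangent_gap_ge0 ?subr_ge0.
Qed.

Lemma int_expN_convex m phi psi (t : R) :
  measurable_fun setT phi -> measurable_fun setT psi -> 0 <= t <= 1 ->
  (forall x, m x = (1 - t) * phi x + t * psi x) ->
  (int_expN m + t%:E * \int[mu]_x (tangent_gap (m x) (psi x))%:E <=
   (1 - t)%:E * int_expN phi + t%:E * int_expN psi)%E.
Proof.
move=> mphi mpsi t01 mE; have /andP[t0 t1] := t01.
have s0 : 0 <= 1 - t by rewrite subr_ge0.
have mm : measurable_fun setT m.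
  by rewrite (funext mE); apply: measurable_funD; apply: measurable_funM.
have mgap := measurable_tangent_gap _ _ mm mpsi.
have expN_ge0 h (x : T) : (0 <= (expR (- h x))%:E)%E.
  by rewrite lee_fin expR_ge0.
have gap_ge0 (x : T) : (0 <= (tangent_gap (m x) (psi x))%:E)%E.
  by rewrite lee_fin tangent_gap_ge0.
rewrite /int_expN -!ge0_integralZl_EFin//; try exact: measurable_expN.
rewrite -!ge0_integralD//; try (by apply: measurable_funeM; exact: measurable_expN);
  try exact: measurable_expN; try (by move=> x _; apply: mule_ge0); last first.
  exact: measurable_funeM.
apply: ge0_le_integral => //.
- by move=> x _; rewrite adde_ge0// mule_ge0.
- apply: emeasurable_funD; first exact: measurable_expN.
  exact: measurable_funeM.
- by apply: emeasurable_funD; apply: measurable_funeM; exact: measurable_expN.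
- by move=> x _; rewrite -!EFinM -!EFinD lee_fin mE; exact: expR_convex_gap.
Qed.

(** * Difference quotients of the integral *)

(** Turns a convexity estimate into one for quotients with steps [t] and [s]; the weight [l] is t /
    s. An infinite [a] makes the right side infinite, and a finite one forces [j] and [k] to be
    finite. *)
Lemma quot_leD (j0 l t s : R) (j k a : \bar R) :
  0 < t -> 0 < s -> l * s = t -> (0 <= j)%E -> (0 <= k)%E -> (0 <= a)%E ->
  (j + t%:E * k <= (1 - l)%:E * j0%:E + l%:E * a)%E ->
  ((j - j0%:E) * t^-1%:E + k <= (a - j0%:E) * s^-1%:E)%E.
Proof.
move=> t0 s0 lst.
case: a => [a| |]//; last first.
  by move=> _ _ _ _; rewrite addye// gt0_mulye ?lte_fin ?invr_gt0// leey.
case: j => [j| |]//; case: k => [k| |]//; rewrite ?gt0_muley ?lte_fin//.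
rewrite -!EFinM -!EFinD !lee_fin => _ _ _.
have l0 : 0 < l by rewrite -(pmulr_lgt0 _ s0) lst.
rewrite ler_pdivlMr// -lst => jka.
have -> : ((j - j0) / (l * s) + k) * s = (j - j0 + l * s * k) / l.
  by field; rewrite !gt_eqF.
by rewrite ler_pdivrMr//; lra.
Qed.

Lemma measurable_potentialD phi psi (t : R) :
  measurable_fun setT phi -> measurable_fun setT psi ->
  measurable_fun setT (fun x => phi x + t * psi x).
Proof. by move=> mphi mpsi; apply: measurable_funD => //; apply: measurable_funM. Qed.

(** The limit keeps the form 0 / (1 + 0), so that it is literally the gap integrand taken at s =
    0. *)
Lemma tangent_gap_cvg (u : R^nat) (a b : R) : u n @[n --> \oo] --> 0 ->
  tangent_gap (a + u n / (1 + u n) * b) b @[n --> \oo] -->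
  tangent_gap (a + 0 / (1 + 0) * b) b.
Proof.
move=> u0.
have m0 : a + u n / (1 + u n) * b @[n --> \oo] --> a + 0 / (1 + 0) * b.
  apply: cvgD; first exact: cvg_cst.
  apply: cvgMr_tmp; apply: cvgM => //; apply: cvgV; first by rewrite addr0.
  by apply: cvgD => //; exact: cvg_cst.
apply: cvgB; first exact: cvg_cst.
apply: cvgM.
  by apply: continuous_cvg; [exact: continuous_expR|exact: cvgN].
apply: cvgB; last exact: cvg_cst.
by apply: cvgD => //; exact: cvg_cst.
Qed.

Lemma int_tangent_gap_ge0 phi psi :
  (0 <= \int[mu]_x (tangent_gap (phi x) (psi x))%:E)%E.
Proof. by apply: integral_ge0 => x _; rewrite lee_fin tangent_gap_ge0. Qed.

Lemma int_expN_quot_nondecreasing phi psi (t s : R) :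
  measurable_fun setT phi -> measurable_fun setT psi ->
  int_expN phi \is a fin_num -> 0 < t -> t <= s ->
  (int_expN_quot phi psi t <= int_expN_quot phi psi s)%E.
Proof.
move=> mphi mpsi fphi t0 ts; have s0 := lt_le_trans t0 ts.
have l01 : 0 <= t / s <= 1 by rewrite ler_pdivrMr// mul1r ts divr_ge0// ltW.
have mE x : phi x + t * psi x = (1 - t / s) * phi x + t / s * (phi x + s * psi x).
  by field; rewrite gt_eqF.
have h := int_expN_convex _ _ _ _ mphi (measurable_potentialD _ _ s mphi mpsi) l01 mE.
(* The added zero takes the place of [k] in [quot_leD]; the gap in [h] is discarded below. *)
rewrite /int_expN_quot -(fineK fphi) -[leLHS]adde0.
apply: (@quot_leD _ (t / s)) => //.
- by rewrite divfK// gt_eqF.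
- exact: int_expN_ge0.
- exact: int_expN_ge0.
rewrite fineK// mule0 adde0; apply: le_trans h.
by rewrite leeDl// mule_ge0 ?int_tangent_gap_ge0// lee_fin divr_ge0// ltW.
Qed.

Lemma int_expN_quot_le phi psi (s : R) :
  measurable_fun setT phi -> measurable_fun setT psi ->
  int_expN phi \is a fin_num -> int_expN psi = int_expN phi -> 0 < s ->
  (int_expN_quot phi psi (s / (1 + s)) +
    \int[mu]_x (tangent_gap (phi x + s / (1 + s) * psi x) (psi x))%:E <=
  int_expN_quot phi phi s)%E.
Proof.
move=> mphi mpsi fphi phipsi s0; have s1 : 0 < 1 + s by rewrite addr_gt0.
set t := s / (1 + s).
have t0 : 0 < t by rewrite divr_gt0.
have t01 : 0 <= t <= 1 by rewrite ler_pdivrMr// mul1r lerDr ler01 ltW.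
have mE x : phi x + t * psi x = (1 - t) * (phi x + s * phi x) + t * psi x.
  by rewrite /t; field; rewrite gt_eqF.
have := int_expN_convex _ _ _ _ (measurable_potentialD _ _ s mphi mphi) mpsi t01 mE.
rewrite phipsi [leRHS]addeC => h.
rewrite /int_expN_quot -(fineK fphi).
(* The choice t = s / (1 + s) is what gives (1 - t) * s = t. *)
apply: (@quot_leD _ (1 - t)) => //.
- by rewrite /t; field; rewrite gt_eqF.
- exact: int_expN_ge0.
- exact: int_tangent_gap_ge0.
- exact: int_expN_ge0.
- by rewrite subKr fineK.
Qed.

(** The factor e = exp(-tc) leaves the first integral; subtracting and adding e I(phi) then splits
    the quotient. *)
Lemma int_expN_quot_shift phi psi (c t : R) :
  measurable_fun setT phi -> measurable_fun setT psi ->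
  int_expN phi \is a fin_num -> 0 < t ->
  int_expN_quot phi (fun x => psi x + c) t =
  ((expR (- (t * c)))%:E * int_expN_quot phi psi t +
   (fine (int_expN phi) * ((expR (- (t * c)) - 1) / t))%:E)%E.
Proof.
move=> mphi mpsi fphi t0; rewrite /int_expN_quot.
have -> : (fun x => phi x + t * (psi x + c)) =
    (fun x => (phi x + t * psi x) + t * c).
  by apply/funext => x; ring.
rewrite int_expN_shift; last exact: measurable_potentialD.
rewrite -(fineK fphi) fineK//.
set e := expR _; have e0 : 0 < e by exact: expR_gt0.
have := int_expN_ge0 (fun x => phi x + t * psi x).
(* If this integral is infinite, both sides are [+oo]. *)
case: (int_expN (fun x => phi x + t * psi x)) => [j| |]// _.
  by rewrite -(fineK fphi) /= -!EFinM -!EFinD; congr EFin; field; rewrite gt_eqF.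
by rewrite -(fineK fphi) !(addye, gt0_muley, gt0_mulye) ?lte_fin ?invr_gt0.
Qed.

(** The quotient is the one defining the derivative of exp(-tc) at t = 0. *)
Lemma expRN_quot_cvg (c : R) : (expR (- (t * c)) - 1) / t @[t --> 0^'+] --> - c.
Proof.
have [/cvg_dnbhs_at_right + cE] : is_derive (0 : R) 1 (fun t => expR (- (t * c))) (- c).
  apply: is_derive_eq.
  by rewrite mul0r oppr0 expR0 mul1r scaler0 add0r /GRing.scale/= mulr1.
move: cE; rewrite /derive => ->; rewrite mul0r oppr0 expR0.
under [X in X @ _ --> _ -> _]eq_fun => t.
  rewrite /= addr0 [t%:A]mulr1 [_ *: _]mulrC; over.
by [].
Qed.

Lemma expRN_cvg1 (c : R) : expR (- (t * c)) @[t --> 0^'+] --> (1 : R).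
Proof.
have h : - (t * c) @[t --> (0 : R)] --> - (0 * c).
  by apply: cvgN; apply: cvgMr_tmp; exact: cvg_id.
have e : expR (- (0 * c)) = 1 by rewrite mul0r oppr0 expR0.
apply: cvg_at_right_filter; rewrite -[X in _ --> X]e.
by apply: continuous_cvg h; exact: continuous_expR.
Qed.

(** * The mixed volume as a one-sided limit *)

Definition mixed_volume phi psi : \bar R :=
  (- lim (int_expN_quot phi psi t @[t --> 0^'+]))%E.

Lemma mixed_volume_ae_eq phi psi :
  measurable_fun setT phi -> measurable_fun setT psi ->
  {ae mu, forall x, phi x = psi x} ->
  mixed_volume phi phi = mixed_volume phi psi.
Proof.
move=> mphi mpsi e; rewrite /mixed_volume.
suff -> : int_expN_quot phi phi = int_expN_quot phi psi by [].
apply/funext => t; rewrite /int_expN_quot.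
rewrite (int_expN_ae_eq (fun x => phi x + t * phi x) (fun x => phi x + t * psi x))//.
- exact: measurable_potentialD.
- exact: measurable_potentialD.
- by move: e; apply: filterS => x <-.
Qed.

Opaque int_expN int_expN_quot tangent_gap.

Lemma int_expN_quot_cvg phi psi :
  measurable_fun setT phi -> measurable_fun setT psi ->
  int_expN phi \is a fin_num ->
  int_expN_quot phi psi t @[t --> 0^'+] -->
  ereal_inf [set int_expN_quot phi psi t | t in [set` `]0, +oo[]].
Proof.
move=> mphi mpsi fphi.
apply: nondecreasing_at_right_cvge => //= t s.
rewrite !in_itv/= !andbT => t0 s0 ts.
exact: int_expN_quot_nondecreasing.
Qed.

Lemma int_expN_quot_cvg_mixed_volume phi psi :
  measurable_fun setT phi -> measurable_fun setT psi ->
  int_expN phi \is a fin_num ->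
  int_expN_quot phi psi t @[t --> 0^'+] --> (- mixed_volume phi psi)%E.
Proof.
move=> mphi mpsi fphi; rewrite oppeK.
by apply/cvg_ex; eexists; exact: int_expN_quot_cvg.
Qed.

Lemma mixed_volume_le_quot phi psi (t : R) :
  measurable_fun setT phi -> measurable_fun setT psi ->
  int_expN phi \is a fin_num -> 0 < t ->
  (- mixed_volume phi psi <= int_expN_quot phi psi t)%E.
Proof.
move=> mphi mpsi fphi t0; rewrite oppeK.
rewrite (cvg_lim _ (int_expN_quot_cvg _ _ mphi mpsi fphi))//.
by apply: ereal_inf_lbound; exists t; rewrite //= in_itv/= andbT.
Qed.

Lemma mixed_volume_shift phi psi (c : R) :
  measurable_fun setT phi -> measurable_fun setT psi ->
  int_expN phi \is a fin_num ->
  mixed_volume phi (fun x => psi x + c) =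
  (mixed_volume phi psi + (c * fine (int_expN phi))%:E)%E.
Proof.
move=> mphi mpsi fphi; have := int_expN_quot_cvg_mixed_volume _ _ mphi mpsi fphi.
move: (mixed_volume phi psi) => V QV; rewrite /mixed_volume.
have -> : (c * fine (int_expN phi))%:E = (- (fine (int_expN phi) * - c)%:E)%E.
  by rewrite -EFinN mulrN opprK mulrC.
rewrite -{1}(oppeK V) -fin_num_oppeD//; congr oppe; apply: cvg_lim => //.
rewrite -[X in (X + _)%E]mul1e.
apply: (@cvg_trans _ (((expR (- (t * c)))%:E * int_expN_quot phi psi t +
   (fine (int_expN phi) * ((expR (- (t * c)) - 1) / t))%:E)%E @[t --> 0^'+])).
  apply: near_eq_cvg; near=> t.
  by apply/esym/int_expN_quot_shift.
(* [V] may be infinite: the sum of limits is defined because one term is finite, the product because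
   the factor 1 is nonzero. *)
apply: cvgeD; first by rewrite fin_num_adde_defl.
  apply: cvgeM.
    have [fI|nI] := boolP ((- V)%E \is a fin_num); first exact: mule_def_fin.
    exact: mule_def_neq0_infty.
    by apply: cvg_EFin; [exact: nearW|exact: expRN_cvg1].
  exact: QV.
apply: cvg_EFin; first exact: nearW.
by apply: cvgMl_tmp; exact: expRN_quot_cvg.
Unshelve. all: by end_near. Qed.

(** * The inequality and its equality case for equal integrals *)

(** The limit is an infimum, hence at most the quotient at s / (1 + s). The gap integral is kept for
    the equality case. *)
Lemma mixed_volume_gap_le phi psi (s : R) :
  measurable_fun setT phi -> measurable_fun setT psi ->
  int_expN phi \is a fin_num -> int_expN psi = int_expN phi -> 0 < s ->
  (- mixed_volume phi psi +
    \int[mu]_x (tangent_gap (phi x + s / (1 + s) * psi x) (psi x))%:E <=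
  int_expN_quot phi phi s)%E.
Proof.
move=> mphi mpsi fphi phipsi s0.
apply: le_trans (int_expN_quot_le _ _ _ mphi mpsi fphi phipsi s0).
apply: leeD2r; apply: mixed_volume_le_quot mphi mpsi fphi _.
by rewrite divr_gt0// addr_gt0.
Qed.

Opaque mixed_volume.

Lemma mixed_volume_self_le phi psi :
  measurable_fun setT phi -> measurable_fun setT psi ->
  int_expN phi \is a fin_num -> int_expN psi = int_expN phi ->
  (mixed_volume phi phi <= mixed_volume phi psi)%E.
Proof.
move=> mphi mpsi fphi phipsi; rewrite -leeN2.
apply: (cvge_ge _ (int_expN_quot_cvg_mixed_volume _ _ mphi mphi fphi)).
near=> s; have s0 : 0 < s by [].
apply: le_trans (mixed_volume_gap_le _ _ _ mphi mpsi fphi phipsi s0).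
by apply: leeDl; exact: int_tangent_gap_ge0.
Unshelve. all: by end_near. Qed.

(** Finiteness allows the mixed volume to be moved across [mixed_volume_gap_le], bounding the gap
    integral by a quantity that tends to 0 with [s]. *)
Lemma mixed_volume_self_eq phi psi :
  measurable_fun setT phi -> measurable_fun setT psi ->
  int_expN phi \is a fin_num -> int_expN psi = int_expN phi ->
  mixed_volume phi phi \is a fin_num ->
  mixed_volume phi psi = mixed_volume phi phi ->
  {ae mu, forall x, phi x = psi x}.
Proof.
move=> mphi mpsi fphi phipsi fV VV.
pose k (s : R) x := tangent_gap (phi x + s / (1 + s) * psi x) (psi x).
have mk s : measurable_fun setT (EFin \o k s).
  exact: measurable_tangent_gap (measurable_potentialD _ _ _ mphi mpsi) mpsi.
have k_le s : 0 < s -> (\int[mu]_x (k s x)%:E <=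
    int_expN_quot phi phi s + mixed_volume phi phi)%E.
  move=> s0; rewrite -(leeBlDr _ _ fV) addeC -VV.
  exact: mixed_volume_gap_le mphi mpsi fphi phipsi s0.
have k0 : (\int[mu]_x (k 0 x)%:E)%E = 0.
  apply/eqP; rewrite eq_le int_tangent_gap_ge0 andbT.
  (* Fatou's lemma along s = 1 / (n + 1): the gaps tend pointwise to [k 0], and their integrals tend
     to 0. *)
  have := @fatou _ _ _ mu _ measurableT (fun n x => (k (harmonic n) x)%:E)
    (fun n => mk _) (fun n x _ => tangent_gap_ge0 _ _).
  have -> : (fun x => limn_einf ((fun n x => (k (harmonic n) x)%:E)^~ x)) =
      EFin \o k 0.
    apply/funext => x /=.
    have /cvg_limn_einf_sup[-> _//] : (k (harmonic n) x)%:E @[n --> \oo] --> (k 0 x)%:E.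
    apply: cvg_EFin; first exact: nearW.
    exact: tangent_gap_cvg cvg_harmonic.
  move=> /le_trans; apply.
  suff lim0 : (\int[mu]_x (k (harmonic n) x)%:E)%E @[n --> \oo] --> 0%E.
    by rewrite (cvg_limn_einf_sup lim0).1.
  apply: (@squeeze_cvge _ _ _ _ (cst 0%E) _
      (fun n => int_expN_quot phi phi (harmonic n) + mixed_volume phi phi)%E).
  - by apply: nearW => n; rewrite int_tangent_gap_ge0 k_le ?harmonic_gt0.
  - exact: cvg_cst.
  have := int_expN_quot_cvg_mixed_volume _ _ mphi mphi fphi.
  move: fV; clear; move: (mixed_volume phi phi) => V fV QV.
  (* The limit 0 is written as - V + V, to match the limits of the two summands. *)
  rewrite -(@subee _ (- V)%E) ?fin_numN// oppeK.
  apply: cvgeD; [by rewrite fin_num_adde_defl| |exact: cvg_cst].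
  move: QV; rewrite -(fineK fV) => /cvge_at_rightP; apply.
  by split => [n|]; [exact: harmonic_gt0|exact: cvg_harmonic].
have /ae_eq_integral_abs : (\int[mu]_x `|(k 0 x)%:E|)%E = 0%E.
  rewrite -[RHS]k0; apply: eq_integral => x _.
  apply: gee0_abs; rewrite lee_fin; exact: tangent_gap_ge0.
move=> /(_ measurableT (mk 0)); apply: filterS => x /(_ I)[].
by rewrite /k mul0r mul0r addr0 => /tangent_gap_eq0.
Qed.

(** * Reduction of the general case to equal integrals *)

(** If [mixed_volume phi phi] is [+oo], the inequality alone forces equality; proportionality is
    therefore deduced from equality under finiteness. *)
Lemma mixed_volume_inequality phi psi (r := fine (int_expN phi))
    (a := fine (int_expN phi) / fine (int_expN psi)) :
  measurable_fun setT phi -> measurable_fun setT psi ->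
  int_expN phi \is a fin_num -> int_expN psi \is a fin_num ->
  (0 < int_expN phi)%E -> (0 < int_expN psi)%E ->
  let proportional :=
    exists2 b : R, 0 < b & {ae mu, forall x, expR (- phi x) = b * expR (- psi x)} in
  [/\ (mixed_volume phi phi + (r * ln a)%:E <= mixed_volume phi psi)%E,
      proportional -> mixed_volume phi psi = (mixed_volume phi phi + (r * ln a)%:E)%E
    & mixed_volume phi phi \is a fin_num ->
      mixed_volume phi psi = (mixed_volume phi phi + (r * ln a)%:E)%E ->
      proportional].
Proof.
have addI x y : (x + (r * ln a)%:E = y + (r * ln a)%:E)%E -> x = y.
  by move=> /(congr1 (fun z => z - (r * ln a)%:E)%E); rewrite !addeK.
move=> mphi mpsi fphi fpsi phi0 psi0 /=.
have a0 : 0 < a by rewrite divr_gt0 ?fine_gt0 ?phi0 ?psi0 ?ltey_eq ?fphi ?fpsi.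
have mpsiD c : measurable_fun setT (fun x => psi x + c).
  by apply: measurable_funD => //; exact: measurable_cst.
(* exp(-psi') = a exp(-psi), and [a] is the ratio of the integrals, so [psi'] and [phi] have equal
   integrals. *)
pose psi' x := psi x + - ln a.
have psi'phi : int_expN psi' = int_expN phi.
  rewrite int_expN_shift// opprK lnK// -(fineK fpsi) -(fineK fphi) -EFinM.
  by congr EFin; rewrite /a divfK// gt_eqF// -lte_fin fineK.
have -> : mixed_volume phi psi = (mixed_volume phi psi' + (r * ln a)%:E)%E.
  by rewrite mixed_volume_shift// -/r mulNr mulrC EFinN subeK.
split.
- by apply: leeD2r; exact: mixed_volume_self_le mphi (mpsiD _) fphi psi'phi.
- move=> [b b0 e].
  suff -> : mixed_volume phi psi' = mixed_volume phi phi by [].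
  have e' : {ae mu, forall x, phi x = psi x + - ln b}.
    move: e; apply: filterS => x /(congr1 (@ln R)).
    rewrite expRK lnM ?posrE ?expR_gt0// expRK => h; lra.
  (* Integrating the proportionality relation identifies [b] with the ratio [a], so that phi = psi'
     almost everywhere. *)
  suff ba : b = a by rewrite ba in e'; exact/esym/(mixed_volume_ae_eq _ _ mphi (mpsiD _)).
  have := int_expN_ae_eq _ _ mphi (mpsiD _) e'.
  rewrite int_expN_shift// opprK lnK// /a => ->.
  by rewrite fineM// mulfK// gt_eqF// -lte_fin fineK.
- move=> fV /addI VV; exists a; first exact: a0.
  have {VV} := mixed_volume_self_eq _ _ mphi (mpsiD _) fphi psi'phi fV VV.
  apply: filterS => x ->.
  by rewrite opprD opprK expRD lnK// mulrC.
Qed.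

End exponential_integral.

(* Specialization to Lebesgue measure *)
Transparent int_expN int_expN_quot tangent_gap mixed_volume.

Theorem theorem3p2 (R : realType) (n : nat) (phi psi : 'rV[R]_n.+1 -> R)
    (f := expN phi) (g := expN psi) :
  integrable_Rn f -> integrable_Rn g ->
  (0 < J f)%E -> (0 < J g)%E ->
  let lhs := dual_mixed_volume phi psi in
  let rhs := (dual_mixed_volume phi phi
              + (fine (J f) * ln (fine (J f) / fine (J g)))%:E)%E in
  let proportional :=
    exists2 a : R, 0 < a & {ae @lebesgue_Rn R n, forall x, f x = a * g x} in
  [/\ (rhs <= lhs)%E,
      proportional -> lhs = rhs
    & dual_mixed_volume phi phi \is a fin_num -> lhs = rhs -> proportional].
Proof.
move=> If Ig Jf0 Jg0; pose Rn := caratheodory_type (@lebesgue_outer R n).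
have mphi := measurable_potential _ Rn R phi (measurable_int _ If).
have mpsi := measurable_potential _ Rn R psi (measurable_int _ Ig).
(* For this measure, [J] and [dual_mixed_volume] agree with [int_expN] and [mixed_volume] by
   unfolding. *)
exact: (mixed_volume_inequality _ Rn R (@lebesgue_Rn R n) phi psi mphi mpsi
  (integrable_fin_num measurableT If) (integrable_fin_num measurableT Ig) Jf0 Jg0).
Qed.
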